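(* Let $X$ be a topological space and let $\mathcal{S}\subset\mathcal{P}(X)$. (1) If $\mathcal{S}$ is an exceedingly rich family, then there exists a family $\mathcal{S}_0\subset\mathcal{S}$ large in the sense of Skolem-like functions. (2) If $\mathcal{S}$ is large in the sense of Skolem-like functions, then there exists a family $\mathcal{S}_0\subset\mathcal{S}$ exceedingly large in the sense of suitable models. (3) If $X$ is metrizable and $\mathcal{S}$ is exceedingly large in the sense of suitable models, then there exists an exceedingly rich family $\mathcal{S}_0\subset\mathcal{S}$.
   Context: For a set $I$, $\mathcal{P}(I)$ is its power set and $|I|$ its cardinality. For a topological space $Z$, $\operatorname{dens}Z$ is the least cardinality of a dense subset, and $\omega$ is the first infinite cardinal. A nonempty family $\mathcal{A}$ of sets is up-directed if for all $A,B\in\mathcal{A}$ there is $C\in\mathcal{A}$ with $A\cup B\subset C$. A family $\mathcal{S}$ of closed subsets of a topological space $X$ is exceedingly rich if: (R-a) for every $Y\subset X$ there is $S\in\mathcal{S}$ with $Y\subset S$ and $\max\{\operatorname{dens}Y,\omega\}=\max\{\operatorname{dens}S,\omega\}$; (R-b) if $\mathcal{A}\subset\mathcal{S}$ is up-directed, then $\overline{\bigcup\mathcal{A}}\in\mathcal{S}$. A function $\phi:\mathcal{P}(I)\to\mathcal{P}(I)$ is Skolem-like if: (S-a) $A\subset\phi(A)$ and $|\phi(A)|\le\max\{|A|,\omega\}$ for every $A\subset I$; (S-b) $A\subset B\subset I$ implies $\phi(A)\subset\phi(B)$; (S-c) for every up-directed family $\mathcal{A}\subset\mathcal{P}(I)$,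 $\phi(\bigcup\mathcal{A})=\bigcup_{A\in\mathcal{A}}\phi(A)$. A family $\mathcal{S}$ of closed subsets of $X$ is large in the sense of Skolem-like functions if there is a Skolem-like function $\phi:\mathcal{P}(X)\to\mathcal{P}(X)$ with $\mathcal{S}=\{\overline{\phi(C)}: C\subset X\}$. Suitable models (working in ZFC): for a set $N$ and a formula $\varphi$ of the language of set theory, the relativization $\varphi^N$ is obtained from $\varphi$ by replacing each quantifier $\forall x$ by $\forall x\in N$ and each $\exists x$ by $\exists x\in N$. A formula $\varphi(x_1,\dots,x_n)$ with all free variables shown is absolute for $N$ if for all $a_1,\dots,a_n\in N$: $\varphi(a_1,\dots,a_n)\Leftrightarrow\varphi^N(a_1,\dots,a_n)$. For a finite list $\Phi$ of formulas and a set $S$, write $M\prec(\Phi;S)$ if $M$ is a set (not necessarily countable) with $S\subset M$ and every $\varphi$ in $\Phi$ is absolute for $M$. A family $\mathcal{S}$ of closed subsets of $X$ is exceedingly large in the sense of suitable models if there are a finite list of formulas $\Phi$ and a countable set $C$ such that $\mathcal{S}=\{\overline{X\cap M}: M\prec(\Phi;C)\}$. *)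

(* Defs.v *)
From Stdlib Require Import List.
From mathcomp Require Import all_boot all_order all_algebra.
From mathcomp Require Import all_classical all_reals all_analysis.

Set Implicit Arguments.
Unset Strict Implicit.
Unset Printing Implicit Defensive.

Local Open Scope classical_set_scope.
Local Open Scope card_scope.

Definition up_directed (T : Type) (AA : set (set T)) : Prop :=
  AA !=set0 /\
  forall A B, AA A -> AA B -> exists2 C, AA C & A `|` B `<=` C.

(* Cardinals are represented by sets, compared with #<= and #=. The set below
   has cardinality max{|A|, omega}; the sum type only serves to have A and the
   natural numbers in one type. *)
Definition max_omega (T : Type) (A : set T) : set (T + nat) :=
  if A #<= [set: nat] then inr @` [set: nat] else inl @` A.

(* D is a dense subset of the subspace Y, of least cardinality: |D| = dens Y. *)
Definition is_dens (X : topologicalType) (Y D : set X) : Prop :=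
  let dense_in E := E `<=` Y /\ Y `<=` closure E in
  dense_in D /\ forall E, dense_in E -> D #<= E.

Definition same_max_dens_omega (X : topologicalType) (Y Z : set X) : Prop :=
  exists D E : set X,
    [/\ is_dens Y D, is_dens Z E & max_omega D #= max_omega E].

Definition exceedingly_rich (X : topologicalType) (S : set (set X)) : Prop :=
  [/\ forall F, S F -> closed F,
      forall Y : set X, exists F,
        [/\ S F, Y `<=` F & same_max_dens_omega Y F]
    & forall AA : set (set X), AA `<=` S -> up_directed AA ->
        S (closure (\bigcup_(A in AA) A))].

Definition skolem_like (I : Type) (phi : set I -> set I) : Prop :=
  [/\ forall A, A `<=` phi A /\ phi A #<= max_omega A,
      forall A B, A `<=` B -> phi A `<=` phi B
    & forall AA : set (set I), up_directed AA ->
        phi (\bigcup_(A in AA) A) = \bigcup_(A in AA) phi A].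

Definition large_skolem (X : topologicalType) (S : set (set X)) : Prop :=
  exists2 phi : set X -> set X,
    skolem_like phi & S = [set closure (phi C) | C in [set: set X]].

Definition metrizable (R : realType) (X : topologicalType) : Prop :=
  exists (M : metricType R) (f : X -> M) (g : M -> X),
    [/\ cancel f g, cancel g f, continuous f & continuous g].

(* The universe of sets. Arbitrary predicates of the metatheory are allowed in
   separation and replacement, so that every subset of (the extension of) an
   element of V, every function between such subsets, etc. is itself an element
   of V, and notions such as countability, topology, closure or metrizability
   mean the same whether they are expressed in V or in the metatheory. *)
Record zfc_universe (V : Type) (mem : V -> V -> Prop) : Prop := ZFCUniverse {
  zfc_extensionality : forall x y, (forall z, mem z x <-> mem z y) -> x = y ;
  zfc_foundation : forall x, (exists y, mem y x) ->
    exists2 y, mem y x & forall z, mem z x -> ~ mem z y ;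
  zfc_pairing : forall x y, exists p, forall z, mem z p <-> z = x \/ z = y ;
  zfc_union : forall x, exists u, forall z,
    mem z u <-> exists2 y, mem y x & mem z y ;
  zfc_powerset : forall x, exists p, forall z,
    mem z p <-> forall w, mem w z -> mem w x ;
  zfc_infinity : exists x,
    (exists2 o, mem o x & forall z, ~ mem z o) /\
    (forall y, mem y x -> exists2 s, mem s x &
       forall z, mem z s <-> mem z y \/ z = y) ;
  zfc_separation : forall (P : V -> Prop) x, exists y, forall z,
    mem z y <-> mem z x /\ P z ;
  zfc_replacement : forall (P : V -> V -> Prop) x,
    (forall w, mem w x -> forall y z, P w y -> P w z -> y = z) ->
    exists y, forall z, mem z y <-> exists2 w, mem w x & P w z ;
  zfc_choice : forall x,
    (forall y, mem y x -> exists z, mem z y) ->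
    (forall y y', mem y x -> mem y' x ->
       (exists z, mem z y /\ mem z y') -> y = y') ->
    exists c, forall y, mem y x -> exists! z, mem z y /\ mem z c
}.

(* Formulas of the language of set theory over the variables x_0, x_1, ...;
   the remaining connectives are the usual classical abbreviations. *)
Inductive formula : Type :=
| FMem of nat & nat
| FEq of nat & nat
| FNeg of formula
| FAnd of formula & formula
| FAll of nat & formula
| FEx of nat & formula.

Fixpoint free_vars (f : formula) : seq nat :=
  match f with
  | FMem i j | FEq i j => [:: i; j]
  | FNeg g => free_vars g
  | FAnd g h => free_vars g ++ free_vars h
  | FAll n g | FEx n g => [seq i <- free_vars g | i != n]
  end.

Definition assign (V : Type) (s : nat -> V) (n : nat) (a : V) : nat -> V :=
  fun i => if i == n then a else s i.

(* Truth of f under the assignment s, all quantifiers being bounded by the class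
   N: for N = setT this is the truth of f, and for N (the extension of) a set it
   is the truth of the relativization of f to N. *)
Fixpoint holds (V : Type) (mem : V -> V -> Prop) (N : set V) (s : nat -> V)
    (f : formula) : Prop :=
  match f with
  | FMem i j => mem (s i) (s j)
  | FEq i j => s i = s j
  | FNeg g => ~ holds mem N s g
  | FAnd g h => holds mem N s g /\ holds mem N s h
  | FAll n g => forall a, N a -> holds mem N (assign s n a) g
  | FEx n g => exists2 a, N a & holds mem N (assign s n a) g
  end.

Definition ext (V : Type) (mem : V -> V -> Prop) (x : V) : set V :=
  [set z | mem z x].

(* Only the values of the free variables are required to lie in N (N may be
   empty). *)
Definition absolute (V : Type) (mem : V -> V -> Prop) (N : V) (f : formula) :
    Prop :=
  forall s : nat -> V, (forall i, i \in free_vars f -> ext mem N (s i)) ->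
    (holds mem setT s f <-> holds mem (ext mem N) s f).

Definition suitable_model (V : Type) (mem : V -> V -> Prop)
    (Phi : seq formula) (C M : V) : Prop :=
  ext mem C `<=` ext mem M /\ List.Forall (absolute mem M) Phi.

(* e identifies the points of X with the elements of a set in the universe. *)
Definition is_set_in_universe (V : Type) (mem : V -> V -> Prop) (X : Type)
    (e : X -> V) : Prop :=
  injective e /\ exists x : V, ext mem x = range e.

(* e @^-1` ext mem M is the intersection of X with M. *)
Definition exceedingly_large_models (V : Type) (mem : V -> V -> Prop)
    (X : topologicalType) (e : X -> V) (S : set (set X)) : Prop :=
  exists (Phi : seq formula) (C : V),
    countable (ext mem C) /\
    S = [set closure (e @^-1` ext mem M) | M in suitable_model mem Phi C].

(* Main.v *)
Require Import Defs.
From mathcomp Require Import all_boot all_order all_algebra.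
From mathcomp Require Import all_classical all_reals all_analysis.

Set Implicit Arguments.
Unset Strict Implicit.
Unset Printing Implicit Defensive.

Import Order.TTheory GRing.Theory Num.Theory.

Local Open Scope classical_set_scope.
Local Open Scope card_scope.

(* (1) Attach to every finite tree t with leaves in X a countable dense subset
   D(t) of a member of S, containing the sets attached to the subtrees of t; then
   phi(A) is the union of the D(t) with t over A, and (R-b) applies to it because
   the trees over A are directed.

   (2) By (S-c), phi is determined by the countable sets phi(s) with s finite. If
   X is uncountable, code finite sequences of points by points; a set closed under
   countably many binary functions on X and containing the code of the empty
   sequence is then a fixed point of phi, and closure of X cap M under a function
   whose graph lies in M follows from the absoluteness of two formulas.

   (3) The Skolem hull in V of a subset A of X, for the subformulas of Phi and
   for countably many functions on X, is a model; psi(A), its trace on X, is an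
   idempotent Skolem-like function. Let D be the union over n of maximal
   1/n-separated sets. For suitable functions, D cap closure(psi(A)) =
   D cap psi(A). So each F = closure(psi(A)) with A included in D is equal to
   closure(psi(D cap F)), and F |-> D cap F turns up-directed families of such
   closed sets into up-directed families of arguments of psi. *)

(** * Infinite cardinals *)

Lemma card_le_inj T U (A : set T) (B : set U) (f : T -> U) :
  (forall x, A x -> B (f x)) ->
  (forall x y, A x -> A y -> f x = f y -> x = y) -> A #<= B.
Proof.
move=> fAB finj.
have /injfunPex[g] : exists2 f : T -> U, set_fun A B f & set_inj A f.
  by exists f => // x y; rewrite !inE; exact: finj.
exact: inj_card_le g.
Qed.

Lemma card_le_ex_inj T U (A : set T) (B : set U) (u : U) : A #<= B ->
  exists f : T -> U, (forall x, A x -> B (f x)) /\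
    (forall x y, A x -> A y -> f x = f y -> x = y).
Proof.
elim/Ppointed: U => U in B u *; first by case: (no u).
move=> /pcard_leP/injfunPex[f fAB finj]; exists f; split=> // x y Ax Ay.
by apply: finj; rewrite inE.
Qed.

Lemma card_le_surj T U (A : set T) (B : set U) (f : U -> T) :
  (forall x, A x -> exists2 y, B y & f y = x) -> A #<= B.
Proof.
move=> fBA; apply: card_le_trans (card_image_le f B); apply: subset_card_le.
by move=> x /fBA[y By <-]; exists y.
Qed.

(** Zorn's lemma is applied to sets [Z] of choice functions for [A], any two of which differ at
    every index. For a maximal [Z], evaluation at some [i] covers [A i], as otherwise one more
    function could be added; then [A i] embeds in [Z], and [Z] in each [A j]. *)
Lemma min_card (I T : Type) (A : I -> set T) (i0 : I) :
  exists i, forall j, A i #<= A j.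
Proof.
pose P (Z : set (I -> T)) := (forall f i, Z f -> A i (f i)) /\
  forall f g i, Z f -> Z g -> f i = g i -> f = g.
have [|Z [[ZA Zinj] Zmax]] := @Zorn_bigcup _ P.
  move=> F FP Ftot; split.
    by move=> f i [Z FZ Zf]; apply: (FP _ FZ).1.
  move=> f g i [Z FZ Zf] [W FW Wg].
  have [ZW|WZ] := Ftot _ _ FZ FW.
    by apply: (FP _ FW).2 => //; apply: ZW.
  by apply: (FP _ FZ).2 => //; apply: WZ.
have [[i Zi]|/forallNP nZ] := pselect (exists i, forall x, A i x -> exists2 f, Z f & f i = x).
  exists i => j; apply: (card_le_trans (card_le_surj Zi)).
  by apply: (card_le_inj (f := fun f : I -> T => f j)) => [f|f g]; [apply: ZA|apply: Zinj].
have /choice[f0 f0P] : forall i, exists x, A i x /\ forall f, Z f -> f i <> x.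
  move=> i; have /existsNP[x /not_implyP[Ax nx]] := nZ i.
  by exists x; split=> // f Zf fx; apply: nx; exists f.
exfalso; apply: (Zmax (Z `|` [set f0])).
  split; first by move=> f Zf; left.
  move=> /(_ f0 (or_intror erefl)) Zf0; by apply: (f0P i0).2 Zf0 _.
split.
  by move=> f i [/ZA//|->]; apply: (f0P i).1.
move=> f g i [Zf|->] [Zg|->] //.
- exact: Zinj.
- by move=> /((f0P i).2 _ Zf).
- by move=> /esym/((f0P i).2 _ Zg).
Qed.

Lemma card_le_total T (A B : set T) : A #<= B \/ B #<= A.
Proof.
have [b bP] := min_card (fun b : bool => if b then A else B) true.
by case: b bP => bP; [left; exact: (bP false)|right; exact: (bP true)].
Qed.

Definition injects_square T (K : set T) (g : T -> T -> T) :=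
  (forall a b, K a -> K b -> K (g a b)) /\
  forall a b c d, K a -> K b -> K c -> K d -> g a b = g c d -> a = c /\ b = d.

Lemma injects_square_le T (K L : set T) g : injects_square L g ->
  K #<= L -> L `<=` K -> exists g', injects_square K g'.
Proof.
move=> [gL ginj] KL LK.
have [->|/set0P[x0 Lx0]] := eqVneq K set0; first by exists (fun x _ => x); split.
have [h [hL hinj]] := card_le_ex_inj x0 KL.
exists (fun a b => g (h a) (h b)); split=> [a b Ka Kb|a b c d Ka Kb Kc Kd e].
  by apply: LK; apply: gL; apply: hL.
by have [] := ginj _ _ _ _ (hL _ Ka) (hL _ Kb) (hL _ Kc) (hL _ Kd) e; split; apply: hinj.
Qed.

(** Hessenberg's theorem. Let [B] carry a maximal partial injection of its square into itself.
    Either the rest of [K] embeds in [B], so that [K] does too, or [B] embeds in the rest and the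
    injection extends. *)
Lemma infinite_injects_square T (K : set T) : infinite_set K ->
  exists g, injects_square K g.
Proof.
move=> /infiniteP; have [->|/set0P[x0 Kx0]] := eqVneq K set0.
  by exists (fun x _ => x); split.
move=> /(card_le_ex_inj x0)[num [numK /(_ _ _ I I)numI]].
(* Partial injections B * B -> B, with B a subset of K, ordered by extension of graphs. *)
pose dom (R : set (T * T * T)) a := exists c, R (a, a, c).
pose P (R : set (T * T * T)) := [/\ (dom R `<=` K),
  (forall a b c, R (a, b, c) -> [/\ dom R a, dom R b & dom R c]),
  (forall a b, dom R a -> dom R b -> exists c, R (a, b, c)),
  (forall a b c c', R (a, b, c) -> R (a, b, c') -> c = c') &
  forall a b c a' b', R (a, b, c) -> R (a', b', c) -> a = a' /\ b = b'].
pose R0 : set (T * T * T) :=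
  [set t | exists m n, t = (num m, num n, num (pickle (m, n)))].
have dR0 m : dom R0 (num m) by exists (num (pickle (m, m))), m, m.
have PR0 : P R0.
  split.
  - by move=> a [c [m [n [-> _ _]]]]; exact: numK.
  - by move=> a b c [m [n [-> -> ->]]]; split.
  - move=> a b [c [m [_ [-> _ _]]]] [d [n [_ [-> _ _]]]].
    by exists (num (pickle (m, n))), m, n.
  - move=> a b c c' [m [n [-> -> ->]]] [m' [n' [emm' enn' ->]]].
    by rewrite (numI _ _ emm') (numI _ _ enn').
  - move=> a b c a' b' [m [n [-> -> ->]]] [m' [n' [-> -> e]]].
    by have /(pcan_inj pickleK)[-> ->] := numI _ _ e.
(* The empty chain also needs an upper bound; joining [R0] to each relation provides it and keeps
   all [num n] in the domain. *)
have [|R [PR Rmax]] := @Zorn_bigcup _ (fun R => P (R0 `|` R)).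
  move=> F FP Ftot.
  have [FN|/set0P F0] := eqVneq F set0; first by rewrite FN bigcup_set0 setU0.
  have -> : R0 `|` \bigcup_(X in F) X = \bigcup_(X in F) (R0 `|` X).
    case: F0 => R FR; apply/seteqP; split=> [t [R0t|[X FX Xt]]|t [X FX [R0t|Xt]]].
    - by exists R => //; left.
    - by exists X => //; right.
    - by left.
    - by right; exists X.
  have tot s t : (\bigcup_(X in F) (R0 `|` X)) s -> (\bigcup_(X in F) (R0 `|` X)) t ->
      exists X, [/\ F X, (R0 `|` X) s & (R0 `|` X) t].
    move=> [X FX Xs] [Y FY Yt]; have [XY|YX] := Ftot _ _ FX FY.
      by exists Y; split=> //; apply: setUS Xs.
    by exists X; split=> //; apply: setUS Yt.
  have sub X a : F X -> dom (R0 `|` X) a -> dom (\bigcup_(X in F) (R0 `|` X)) a.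
    by move=> FX [c Xc]; exists c, X.
  split.
  - by move=> a [c [X FX Xc]]; have [+ _ _ _ _] := FP _ FX; apply; exists c.
  - move=> a b c [X FX Xc]; have [_ + _ _ _] := FP _ FX => /(_ _ _ _ Xc)[].
    by split; apply: sub FX _.
  - move=> a b [c ac] [d bd]; have [X [FX Xa Xb]] := tot _ _ ac bd.
    have [_ _ + _ _] := FP _ FX => /(_ a b)[||e Xe]; [by exists c|by exists d|].
    by exists e, X.
  - move=> a b c c' ac bc; have [X [FX Xa Xb]] := tot _ _ ac bc.
    by have [_ _ _ + _] := FP _ FX; apply; eassumption.
  - move=> a b c a' b' ac bc; have [X [FX Xa Xb]] := tot _ _ ac bc.
    by have [_ _ _ _ +] := FP _ FX; apply; eassumption.
move: PR; set Q := R0 `|` R; move=> [QK Qd Qtot Qfun Qinj].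
pose B := dom Q.
have numB n : B (num n) by have [c Rc] := dR0 n; exists c; left.
have /choice[g' g'P] : forall ab : T * T, exists c, B ab.1 -> B ab.2 -> Q (ab, c).
  move=> [a b]; have [[Ba Bb]|/not_andP nB] := pselect (B a /\ B b).
    by have [c] := Qtot _ _ Ba Bb; exists c.
  by exists x0 => Ba Bb; case: nB.
pose g a b := g' (a, b).
have gP a b : B a -> B b -> Q (a, b, g a b) by exact: (g'P (a, b)).
have gB : injects_square B g.
  split=> [a b Ba Bb|a b c d Ba Bb Bc Bd e].
    by have [] := Qd _ _ _ (gP _ _ Ba Bb).
  by apply: (Qinj _ _ (g a b)); [apply: gP|rewrite e; apply: gP].
have [gBB ginj] := gB.
have [KB|BK] := card_le_total (K `\` B) B.
  apply: (injects_square_le gB) => //.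
  have [h [hB hinj]] := card_le_ex_inj x0 KB.
  (* The two pieces of [K] are told apart by the tags [num 0] and [num 1]. *)
  apply: (card_le_inj (f := fun x => if `[< B x >] then g (num 0) x else g (num 1) (h x))).
    move=> x Kx; case: asboolP => Bx; apply: gBB => //.
    exact: hB.
  move=> x y Kx Ky; case: asboolP => Bx; case: asboolP => By.
  - by move=> /ginj[].
  - by move=> /(ginj _ _ _ _ (numB 0) Bx (numB 1) (hB _ (conj Ky By)))[/numI].
  - by move=> /(ginj _ _ _ _ (numB 1) (hB _ (conj Kx Bx)) (numB 0) By)[/numI].
  - by move=> /(ginj _ _ _ _ (numB 1) (hB _ (conj Kx Bx)) (numB 1) (hB _ (conj Ky By)))[_ /hinj->].
exfalso; have [h [hB hinj]] := card_le_ex_inj x0 BK.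
(* [B `|` h @` B] splits its square into that of [B] and three more copies of it, which are
   sent to [h @` B]: a proper extension of [Q]. *)
pose cp (i : bool) x := if i then h x else x.
have cpinj i j x y : B x -> B y -> cp i x = cp j y -> i = j /\ x = y.
  case: i j => [] [] /= Bx By.
  - by move=> /hinj->.
  - by move=> e; have [] := hB _ Bx; rewrite e.
  - by move=> e; have [] := hB _ By; rewrite -e.
  - by [].
(* Four distinct tags in [B], one per block of the square; they keep the images of the three new
   blocks disjoint within the range of [h]. *)
pose nm (i j : bool) := num (i + 2 * j).
have nminj i j i' j' : nm i j = nm i' j' -> i = i' /\ j = j'.
  by move/numI; case: i j i' j' => [] [] [] [].
pose val (i j : bool) a b := if i || j then h (g (nm i j) (g a b)) else g a b.
pose R1 : set (T * T * T) := [set t | exists i j a b,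
  [/\ B a, B b & t = (cp i a, cp j b, val i j a b)]].
have valB i j a b : B a -> B b -> exists k c, B c /\ val i j a b = cp k c.
  move=> Ba Bb; exists (i || j), (if i || j then g (nm i j) (g a b) else g a b).
  rewrite /val; case: (i || j) => /=; split=> //; last exact: gBB.
  by apply: (gBB); [exact: numB|exact: gBB].
have dR1 i a : B a -> dom R1 (cp i a).
  by move=> Ba; exists (val i i a a), i, i, a, a.
have QR1 t : Q t -> R1 t.
  move: t => [[a b] c] Qt; have [Ba Bb Bc] := Qd _ _ _ Qt.
  by exists false, false, a, b; split=> //=; rewrite (Qfun _ _ _ _ Qt (gP _ _ Ba Bb)).
apply: (Rmax R1).
  split; first by move=> t Rt; apply: QR1; right.
  move=> R1R; have [_ hnB] := hB _ (numB 0); apply: hnB.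
  by have [c R1c] := dR1 true _ (numB 0); exists c; right; apply: R1R.
rewrite (_ : R0 `|` R1 = R1); last first.
  by apply/setUidr => t R0t; apply: QR1; left.
split.
- move=> a [c [i [_ [x [_ [Bx _ [-> _ _]]]]]]]; case: i => /=; last exact: QK.
  by have [] := hB _ Bx.
- move=> a b c [i [j [x [y [Bx By [-> -> ->]]]]]]; split; try exact: dR1.
  by have [k [z [Bz ->]]] := valB i j _ _ Bx By; exact: dR1.
- move=> a b [c [i [_ [x [_ [Bx _ [-> _ _]]]]]]] [d [j [_ [y [_ [By _ [-> _ _]]]]]]].
  by exists (val i j x y), i, j, x, y.
- move=> a b c c' [i [j [x [y [Bx By [-> -> ->]]]]]] [i' [j' [x' [y' [Bx' By' [+ + ->]]]]]].
  by move=> /cpinj[]// -> -> /cpinj[]// -> ->.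
- move=> a b c a' b' [i [j [x [y [Bx By [-> -> ->]]]]]] [i' [j' [x' [y' [Bx' By' [-> ->]]]]]].
  have Bg := gBB _ _ Bx By; have Bg' := gBB _ _ Bx' By'.
  have gg' : g x y = g x' y' -> x = x' /\ y = y' by apply: ginj.
  have hnB z : B z -> ~ B (h z) by move=> /hB[].
  rewrite /val; case: ifPn => ij; case: ifPn => ij'.
  + move=> /hinj e.
    have nB k l : B (nm k l) by exact: numB.
    have [||/nminj[-> ->] /gg'[-> ->]] // := ginj _ _ _ _ (nB _ _) Bg (nB _ _) Bg' (e _ _).
      by apply: (gBB) => //; exact: nB.
    by apply: (gBB) => //; exact: nB.
  + by move=> e; case: (hnB (g (nm i j) (g x y))); [apply: (gBB) => //; exact: numB|rewrite e].
  + by move=> e; case: (hnB (g (nm i' j') (g x' y'))); [apply: (gBB) => //; exact: numB|rewrite -e].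
  + move=> /gg'[-> ->]; move: ij ij'; rewrite !negb_or.
    by case: i; case: j; case: i'; case: j'.
Qed.

(** * Trees and hulls *)

Lemma card_inl T (A : set T) : (inl @` A : set (T + nat)) #= A.
Proof. by apply: inj_card_eq => x y _ _ []. Qed.

Lemma card_inr T : (inr @` [set: nat] : set (T + nat)) #= [set: nat].
Proof. by apply: inj_card_eq => x y _ _ []. Qed.

Lemma max_omega_le T U (A : set T) (K : set U) :
  infinite_set K -> A #<= K -> max_omega A #<= K.
Proof.
move=> /infiniteP nK AK; rewrite /max_omega; case: ifP => _.
  by rewrite (card_le_eql (card_inr _)).
by rewrite (card_le_eql (card_inl _)).
Qed.

Lemma card_le_max_omega T (A : set T) : A #<= max_omega A.
Proof.
rewrite /max_omega; case: ifP => [cA|_]; first by rewrite (card_le_eqr (card_inr _)).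
by rewrite (card_le_eqr (card_inl _)).
Qed.

Lemma infinite_max_omega T (A : set T) : infinite_set (max_omega A).
Proof.
rewrite /max_omega; case: ifPn => [cA|/negP ncA].
  by apply/infiniteP; rewrite (card_le_eqr (card_inr _)).
apply/infiniteP; rewrite (card_le_eqr (card_inl _)); apply/infiniteP => /finite_set_countable.
exact: ncA.
Qed.

Lemma max_omega_le2 T U (A : set T) (B : set U) :
  A #<= max_omega B -> max_omega A #<= max_omega B.
Proof. exact/max_omega_le/infinite_max_omega. Qed.

Lemma max_omega_countable T (A : set T) : countable A -> countable (max_omega A).
Proof. exact/max_omega_le/infinite_nat. Qed.

Lemma countable_le T U (A : set T) (K : set U) :
  infinite_set K -> countable A -> A #<= K.
Proof. by move=> /infiniteP nK cA; apply: card_le_trans cA nK. Qed.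

(** A [Prop]-valued version of [all], for undecidable predicates; as a fold it lets [tree_over]
    recurse through lists of subtrees. *)
Definition all_prop T (P : T -> Prop) (s : seq T) : Prop :=
  foldr (fun x Q => P x /\ Q) True s.

Lemma all_prop_cat T (P : T -> Prop) s1 s2 :
  all_prop P (s1 ++ s2) <-> all_prop P s1 /\ all_prop P s2.
Proof. by elim: s1 => [|x s IH] /=; [tauto|rewrite IH; tauto]. Qed.

Lemma all_propW T (P Q : T -> Prop) s :
  (forall x, P x -> Q x) -> all_prop P s -> all_prop Q s.
Proof. by move=> PQ; elim: s => //= x s IH [/PQ ? /IH]. Qed.

(** Folding a pairing function of [K] codes sequences injectively among those of equal length; the
    length is then paired with the code. *)
Lemma card_all_prop T U (A : set T) (K : set U) : infinite_set K -> A #<= K ->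
  [set s | all_prop A s] #<= K.
Proof.
move=> infK AK; have [u0 _] := infinite_setN0 infK.
have [h [hK hinj]] := card_le_ex_inj u0 AK.
have [num [numK /(_ _ _ I I)numI]] := card_le_ex_inj u0 ((infiniteP K).1 infK).
have [g [gK ginj]] := infinite_injects_square infK.
pose cs := foldr (fun x u => g (h x) u) (num 0).
have csK s : all_prop A s -> K (cs s).
  by elim: s => [_|x s IH /= [Ax As]]; [exact: numK|apply: gK; [exact: hK|exact: IH]].
have csinj s t : all_prop A s -> all_prop A t -> size s = size t -> cs s = cs t -> s = t.
  elim: s t => [|x s IH] [|y t] //= [Ax As] [Ay At] [st].
  move=> /(ginj _ _ _ _ (hK _ Ax) (csK _ As) (hK _ Ay) (csK _ At))[/hinj-> // /IH->//].
apply: (card_le_inj (f := fun s => g (num (size s)) (cs s))).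
  by move=> s As; apply: gK; [exact: numK|exact: csK].
move=> s t As At /(ginj _ _ _ _ (numK _ I) (csK _ As) (numK _ I) (csK _ At))[/numI].
exact: csinj.
Qed.

(** Only the leaves are constrained. Such trees are the terms with constants in [A], the label of a
    node being the index of an operation. *)
Fixpoint tree_over T (A : set T) (t : GenTree.tree T) : Prop :=
  match t with
  | GenTree.Leaf x => A x
  | GenTree.Node _ l => all_prop (tree_over A) l
  end.

Lemma tree_overW T (A B : set T) t : A `<=` B -> tree_over A t -> tree_over B t.
Proof.
move=> AB; elim: t => [x|n l IH] /=; first exact: AB.
by elim: l IH => //= t l IH [tAB /IH lAB] [/tAB ? /lAB].
Qed.

Lemma tree_over_directed T (AA : set (set T)) t : up_directed AA ->
  tree_over (\bigcup_(A in AA) A) t -> exists2 A, AA A & tree_over A t.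
Proof.
move=> [[A0 AA0] dir]; elim: t => [x [A AAA Ax]|n l IH] /=; first by exists A.
elim: l IH => [_ _|t l IHl /= [IHt /IHl{}IHl]]; first by exists A0.
move=> [/IHt[A AAA At] /IHl[B AAB Bl]]; have [C AAC ABC] := dir _ _ AAA AAB.
exists C => //; split; first by apply: tree_overW At => x Ax; apply: ABC; left.
by apply: all_propW Bl => u; apply: tree_overW => x Bx; apply: ABC; right.
Qed.

(** [GenTree.encode] embeds trees into finite sequences of labels and leaves, which [card_all_prop]
    counts. *)
Lemma card_tree_over T U (A : set T) (K : set U) : infinite_set K -> A #<= K ->
  tree_over A #<= K.
Proof.
move=> infK AK; pose Q : set (nat + T) := [set y | if y is inr x then A x else True].
have QK : Q #<= K.
  have -> : Q = inl @` [set: nat] `|` inr @` A.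
    apply/seteqP; split=> [[n|x] //= Qx|y [[n _ <-]|[x Ax <-]]//]; first by left; exists n.
    by right; exists x.
  have [u0 _] := infinite_setN0 infK.
  have [h [hK hinj]] := card_le_ex_inj u0 AK.
  have [num [numK /(_ _ _ I I)numI]] := card_le_ex_inj u0 ((infiniteP K).1 infK).
  have [g [gK ginj]] := infinite_injects_square infK.
  apply: (card_le_inj (f := fun y => match y with
    inl n => g (num 0) (num n) | inr x => g (num 1) (h x) end)).
    by move=> y [[n _ <-]|[x Ax <-]]; apply: gK; do ?[exact: numK|exact: hK].
  move=> y z [[n _ <-]|[x Ax <-]] [[m _ <-]|[x' Ax' <-]].
  - by case/ginj; do ?exact: numK; move=> _ /numI->.
  - by case/ginj; do ?[exact: numK|exact: hK]; move=> /numI.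
  - by case/ginj; do ?[exact: numK|exact: hK]; move=> /numI.
  - by case/ginj; do ?[exact: numK|exact: hK]; move=> _ /hinj->.
apply: card_le_trans (card_all_prop infK QK).
apply: (card_le_inj (f := @GenTree.encode T)) => [t|s t _ _]; last first.
  exact: (pcan_inj (GenTree.codeK T)).
rewrite /= ; elim: t => [x|n l IH] //= Al; split=> //.
rewrite -cats1; apply/all_prop_cat; split=> //.
elim: l IH Al => //= t l IHl [IHt /IHl{}IHl] [/IHt At /IHl Al].
exact/all_prop_cat.
Qed.

Lemma countable_ex_range T (A : set T) (x0 : T) : countable A ->
  exists u : nat -> T, A `<=` range u.
Proof.
move=> /(card_le_ex_inj 0)[h [_ hinj]].
have /choice[u uP] : forall n, exists x, forall y, A y -> h y = n -> y = x.
  move=> n; have [[y [Ay <-]]|ny] := pselect (exists y, A y /\ h y = n).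
    by exists y => z Az; apply: hinj.
  by exists x0 => y Ay hy; case: ny; exists y.
by exists u => x Ax; exists (h x) => //; rewrite -(uP _ x).
Qed.

Lemma card_bigcup_tree_over T U W (A : set T) (K : set U)
    (F : GenTree.tree T -> set W) : infinite_set K -> A #<= K ->
  (forall t, countable (F t)) -> \bigcup_(t in tree_over A) F t #<= K.
Proof.
move=> infK AK cF.
have [->|/set0P[w0 _]] := eqVneq (\bigcup_(t in tree_over A) F t) set0.
  exact: card_ge0.
have /choice[en enP] : forall t, exists en : nat -> W, F t `<=` range en.
  by move=> t; exact: countable_ex_range.
apply: card_le_trans (card_tree_over infK AK).
(* The [n]-th point attached to [t] is named by the tree with root [n] and sole subtree [t], again
   over [A]; counting trees is therefore enough. *)
apply: (card_le_surj (f := fun t => if t is GenTree.Node n [:: t'] then en t' n else w0)).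
move=> w [t At /enP[n _ <-]]; exists (GenTree.Node n [:: t]) => //.
Qed.

(** A tree has finitely many leaves, so in a directed union they all lie in one member, which gives
    (S-c); counting trees gives (S-a). *)
Lemma skolem_like_bigcup T (F : GenTree.tree T -> set T) :
  (forall t, countable (F t)) -> (forall x, F (GenTree.Leaf x) x) ->
  skolem_like (fun A => \bigcup_(t in tree_over A) F t).
Proof.
move=> cF Fx; split=> [A|A B AB|AA dir].
- split; first by move=> x Ax; exists (GenTree.Leaf x).
  apply: card_bigcup_tree_over => //; first exact: infinite_max_omega.
  exact: card_le_max_omega.
- by move=> x [t At Ft]; exists t => //; apply: tree_overW AB At.
- apply/seteqP; split=> [x [t /(tree_over_directed dir)[A AAA At] Fx']|].
    by exists A => //; exists t.
  move=> x [A AAA [t At Fx']]; exists t => //.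
  by apply: tree_overW At => y Ay; exists A.
Qed.

Section Hull.
Variables (T V : Type) (e : T -> V) (F : nat -> seq V -> V).

Fixpoint tree_eval (t : GenTree.tree T) : V :=
  match t with
  | GenTree.Leaf x => e x
  | GenTree.Node n l => F n [seq tree_eval t | t <- l]
  end.

Definition hull (A : set T) : set V := tree_eval @` tree_over A.

Lemma hull_op A n l : all_prop (hull A) l -> hull A (F n l).
Proof.
move=> Al; suff [l' Al' <-] : exists2 l', all_prop (tree_over A) l' & map tree_eval l' = l.
  by exists (GenTree.Node n l').
elim: l Al => [|v l IH] /=; first by exists [::].
by move=> [[t At <-] /IH[l' Al' <-]]; exists (t :: l').
Qed.

Lemma hull_min A (B : set V) : (forall x, A x -> B (e x)) ->
  (forall n l, all_prop B l -> B (F n l)) -> hull A `<=` B.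
Proof.
move=> AB BF _ [t + <-]; elim: t => [x|n l IH] /=; first exact: AB.
by move=> Al; apply: BF; elim: l IH Al => //= t l IHl [IHt /IHl{}IHl] [/IHt ? /IHl].
Qed.

(** This makes the trace of the hull on [T] an idempotent operation. *)
Lemma hull_preimage A : hull (e @^-1` hull A) `<=` hull A.
Proof. by apply: hull_min => // n l; exact: hull_op. Qed.

Lemma card_hull U A (K : set U) : infinite_set K -> A #<= K -> hull A #<= K.
Proof. by move=> iK AK; apply: card_le_trans (card_image_le _ _) (card_tree_over iK AK). Qed.

(** As [e] is injective, each tree contributes at most one point of [T]. *)
Lemma skolem_like_hull : injective e -> skolem_like (fun A => e @^-1` hull A).
Proof.
move=> einj; have -> : (fun A => e @^-1` hull A) =
    (fun A => \bigcup_(t in tree_over A) e @^-1` [set tree_eval t]).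
  apply/funext => A; apply/seteqP; split=> [x [t At ex]|x [t At ex]]; first by exists t.
  by exists t.
apply: skolem_like_bigcup => // t.
apply: (@card_le_inj _ _ _ _ (fun=> 0)) => // x y /= ex ey _.
by apply: einj; rewrite ex ey.
Qed.

End Hull.

(** * From rich families to Skolem-like functions *)

Lemma ex_dens (X : topologicalType) (Y : set X) : exists D, is_dens Y D.
Proof.
pose I := {E : set X | E `<=` Y /\ Y `<=` closure E}.
have YY : Y `<=` Y /\ Y `<=` closure Y by split=> //; exact: subset_closure.
have [[D dD] minD] := min_card (fun i : I => sval i) (exist _ Y YY).
by exists D; split=> // E dE; exact: (minD (exist _ E dE)).
Qed.

Lemma countableU T (A B : set T) : countable A -> countable B -> countable (A `|` B).
Proof.
move=> cA cB; have -> : A `|` B = \bigcup_(b in [set: bool]) if b then A else B.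
  apply/seteqP; split=> [x [Ax|Bx]|x [[] _]]; [by exists true|by exists false|by left|by right].
by apply: bigcup_countable => //; case.
Qed.

Lemma closure_sub_closed (X : topologicalType) (A F : set X) :
  closed F -> A `<=` F -> closure A `<=` F.
Proof. by move=> /closure_id cF /closureS; rewrite -cF. Qed.

Lemma closure_bigcup_closure (X : topologicalType) I (P : set I) (F : I -> set X) :
  closure (\bigcup_(i in P) closure (F i)) = closure (\bigcup_(i in P) F i).
Proof.
apply/seteqP; split; last first.
  by apply: closureS => x [i Pi Fx]; exists i => //; exact: subset_closure.
apply: closure_sub_closed => [|x]; first exact: closed_closure.
move=>  [i Pi]; apply: closureS => y Fy.
by exists i.
Qed.

(** (R-a) yields a member [F] of countable density; the required set is a countable dense subset of
    [F] together with [Y]. *)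
Lemma exceedingly_rich_countable (X : topologicalType) (S : set (set X)) (Y : set X) :
  exceedingly_rich S -> countable Y ->
  exists E, [/\ countable E, Y `<=` E & S (closure E)].
Proof.
move=> [Sc SY _] cY; have [F [SF YF [D [E [[dD minD] [[EF FE] _] DE]]]]] := SY Y.
exists (E `|` Y); split; last 2 first.
- by move=> x; right.
- suff -> : closure (E `|` Y) = F by [].
  apply/seteqP; split; last by move=> x /FE; apply: closureS; left.
  by apply: closure_sub_closed => [|x [/EF|/YF]//]; exact: Sc.
have cD : countable D.
  by apply: card_le_trans cY; apply: minD; split=> //; exact: subset_closure.
have cE : countable E.
  apply: card_le_trans (card_le_max_omega E) _; rewrite -(card_le_eql DE).
  exact: max_omega_countable.
exact: countableU.
Qed.

Lemma exceedingly_rich_skolem (X : topologicalType) (S : set (set X)) :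
  exceedingly_rich S -> exists2 S0 : set (set X), S0 `<=` S & large_skolem S0.
Proof.
move=> Srich; have [_ _ Sdir] := Srich.
have /choice[ex exP] : forall Y : set X, exists E, countable Y ->
    [/\ countable E, Y `<=` E & S (closure E)].
  move=> Y; have [cY|ncY] := pselect (countable Y); last by exists Y.
  by have [E] := exceedingly_rich_countable Srich cY; exists E.
pose D := fix D (t : GenTree.tree X) : set X := match t with
  | GenTree.Leaf x => ex [set x]
  | GenTree.Node _ l => ex (foldr (fun t Y => D t `|` Y) set0 l)
  end.
(* The union formed inside the recursion, so that the value of [D] at a node with subtrees [l] is
   [ex (Dn l)]. *)
pose Dn := foldr (fun t Y => D t `|` Y) set0.
have cD t : countable (D t) /\ S (closure (D t)).
  elim: t => [x|n l IH] /=; first by have [] := exP _ (countable1 x).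
  suff : countable (Dn l) by move=> /exP[].
  by elim: l IH => //= t l IHl [[cDt _] /IHl]; exact: countableU.
have cDn l : countable (Dn l) by elim: l => //= t l; apply: countableU; have [] := cD t.
pose phi (A : set X) := \bigcup_(t in tree_over A) D t.
exists [set closure (phi C) | C in [set: set X]]; last first.
  exists phi => //; apply: skolem_like_bigcup => [t|x]; first by have [] := cD t.
  by have [_ + _] := exP _ (countable1 x); apply.
move=> _ [C _ <-]; rewrite /phi -closure_bigcup_closure.
have -> : \bigcup_(t in tree_over C) closure (D t) =
    \bigcup_(A in [set closure (D t) | t in tree_over C]) A by rewrite bigcup_image.
apply: Sdir; first by move=> _ [t _ <-]; have [] := cD t.
(* The tree without leaves is over every [C], even the empty one. Below, the upper bound for [t] and
   [u] comes from the node with these two subtrees. *)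
split; first by exists (closure (D (GenTree.Node 0 [::]))), (GenTree.Node 0 [::]).
move=> _ _ [t Ct <-] [u Cu <-].
have [_ sub _] := exP _ (cDn [:: t; u]).
exists (closure (D (GenTree.Node 0 [:: t; u]))); first by exists (GenTree.Node 0 [:: t; u]).
rewrite -closureU; apply: closureS => x [tx|ux]; apply: sub; rewrite /Dn /=.
  by left.
by right; left.
Qed.

(** * Sets of the universe *)

Section Universe.
Variables (V : Type) (mem : V -> V -> Prop).
Hypothesis HV : zfc_universe mem.

Definition small (A : set V) := exists v, ext mem v = A.

Lemma ext_inj : injective (ext mem).
Proof.
move=> x y xy; apply: (zfc_extensionality HV) => z.
by have : ext mem x z <-> ext mem y z by rewrite xy.
Qed.

Lemma smallP (A : set V) : (exists v, forall z, mem z v <-> A z) -> small A.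
Proof. by move=> [v vP]; exists v; apply/seteqP; split=> z /vP. Qed.

Lemma small_sub A B : small A -> B `<=` A -> small B.
Proof.
move=> [v <-] BA; apply: smallP; have [w wP] := zfc_separation HV B v.
exists w => z; rewrite wP; split=> [[]//|Bz]; split=> //; exact: BA.
Qed.

Lemma small_image A (f : V -> V) : small A -> small (f @` A).
Proof.
move=> [v <-]; apply: smallP.
have [w _ y z -> ->//|w wP] := zfc_replacement HV (P := fun w z => z = f w) (x := v).
by exists w => z; rewrite wP; split=> [[a av ->]|[a av <-]]; exists a.
Qed.

(** For [m < n] the iterated successor [num m] is a member of [num n]; by foundation no set is its
    own member, so the iterates are distinct. *)
Lemma small_infinite : exists2 A, small A & infinite_set A.
Proof.
have [N [[z0 Nz0 _] NS]] := zfc_infinity HV.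
exists (ext mem N); first by exists N.
have /choice[sc scP] : forall y, exists s, mem y N ->
    mem s N /\ forall z, mem z s <-> mem z y \/ z = y.
  by move=> y; have [/NS[s Ns sP]|nNy] := pselect (mem y N); [exists s|exists z0].
pose num n := iter n sc z0.
have Nnum n : mem (num n) N by elim: n => //= n /scP[].
have num_lt m n : (m < n)%N -> mem (num m) (num n).
  elim: n => // n IH; rewrite ltnS leq_eqVlt => mn /=; apply/(scP _ (Nnum n)).2.
  by case/orP: mn => [/eqP->|/IH]; [right|left].
have irr x : ~ mem x x.
  have [p pP] := zfc_pairing HV x x.
  have [|y /pP yx yP] := zfc_foundation HV (x := p); first by exists x; apply/pP; left.
  have {}yx : y = x by case: yx.
  rewrite yx in yP.
  by apply: yP; apply/pP; left.
apply/infiniteP; apply: (card_le_inj (f := num)) => [n _|m n _ _ mn]; first exact: Nnum.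
by case: (ltngtP m n) => // /num_lt; rewrite mn => /irr.
Qed.

Lemma small_set0 : small set0.
Proof. by have [A sA _] := small_infinite; apply: small_sub sA _. Qed.

(** Replacement along a left inverse [f] of an injection from [B] to [A]. *)
Lemma small_card_le A B : small A -> B #<= A -> small B.
Proof.
move=> sA BA; have [->|/set0P[b0 Bb0]] := eqVneq B set0; first exact: small_set0.
have [h [hA hinj]] := card_le_ex_inj b0 BA.
have /choice[f fP] : forall a, exists b, forall b', B b' -> h b' = a -> b' = b.
  move=> a; have [[b [Bb <-]]|nb] := pselect (exists b, B b /\ h b = a).
    by exists b => b' Bb'; apply: hinj.
  by exists b0 => b' Bb' hb'; case: nb; exists b'.
apply: small_sub (small_image f sA) _ => b Bb.
by exists (h b); [exact: hA|rewrite -(fP _ b)].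
Qed.

Lemma small_countable A : countable A -> small A.
Proof.
have [B sB iB] := small_infinite; move=> cA; apply: small_card_le sB _.
exact: countable_le.
Qed.

Lemma small_bigcup A (B : V -> set V) : small A -> (forall a, small (B a)) ->
  small (\bigcup_(a in A) B a).
Proof.
move=> sA /choice[b bP]; have [v vP] := small_image b sA; apply: smallP.
have [u uP] := zfc_union HV v; exists u => z; rewrite uP; split.
  move=> [y yv zy]; have : ext mem v y by [].
  by rewrite vP => -[a Aa ay]; exists a => //; rewrite -(bP a) ay.
move=> [a Aa Bz]; exists (b a); first by suff : ext mem v (b a) by []; rewrite vP; exists a.
by suff : ext mem (b a) z by []; rewrite bP.
Qed.

Section SmallType.
Variables (X : Type) (e : X -> V).
Hypothesis He : is_set_in_universe mem e.

Lemma small_range (f : X -> V) : small (range f).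
Proof.
have [einj sX] := He; apply: small_card_le sX _.
apply: card_le_trans (card_image_le _ _) _.
by apply: (card_le_inj (f := e)) => // x y _ _ /einj.
Qed.

(** Used to see that a Skolem hull is a set: its size is bounded either by omega or by that of
    [X]. *)
Lemma small_le_max_omega (A : set X) (B : set V) : B #<= max_omega A -> small B.
Proof.
have [einj sX] := He; rewrite /max_omega; case: ifPn => [cA|ncA].
  by rewrite (card_le_eqr (card_inr _)); exact: small_countable.
rewrite (card_le_eqr (card_inl _)) => BA; apply: small_card_le sX _.
apply: card_le_trans BA _.
by apply: (card_le_inj (f := e)) => [x _|x y _ _ /einj//]; exists x.
Qed.

Lemma small_range2 (f : X -> X -> V) : small [set v | exists a b, v = f a b].
Proof.
have [einj _] := He.
(* Unions are indexed by elements of [V], so the family of ranges of [f a] is carried along [e] and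
   made empty elsewhere. *)
have /choice[B BP] : forall v, exists B : set V, small B /\
    forall a, v = e a -> B = range (f a).
  move=> v; have [[a ->]|na] := pselect (exists a, v = e a).
    by exists (range (f a)); split; [exact: small_range|move=> b /einj->].
  by exists set0; split; [exact: small_set0|move=> a va; case: na; exists a].
apply: small_sub (small_bigcup (small_range e) (fun a => (BP a).1)) _.
move=> _ [a [b ->]]; exists (e a); first by exists a.
by rewrite ((BP (e a)).2 a erefl); exists b.
Qed.

End SmallType.

Lemma ex_upair : exists u : V -> V -> V, forall a b, ext mem (u a b) = [set a; b].
Proof.
have /choice[u uP] : forall ab : V * V, exists p, forall z, mem z p <-> z = ab.1 \/ z = ab.2.
  by move=> ab; exact: zfc_pairing.
by exists (fun a b => u (a, b)) => a b; apply/seteqP; split=> z /(uP (a, b)).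
Qed.

End Universe.

(** The terms compared are Kuratowski pairs {{a}, {a, b}}. *)
Lemma opair_inj V (mem : V -> V -> Prop) (u : V -> V -> V) :
  (forall a b, ext mem (u a b) = [set a; b]) ->
  forall a b c d, u (u a a) (u a b) = u (u c c) (u c d) -> a = c /\ b = d.
Proof.
move=> uP; have uE a b c d : u a b = u c d -> (a = c /\ b = d) \/ (a = d /\ b = c).
  move=> /(congr1 (ext mem)); rewrite !uP => /seteqP[s1 s2].
  have := (s1 a (or_introl erefl), s1 b (or_intror erefl),
    s2 c (or_introl erefl), s2 d (or_intror erefl)).
  by move=> [[[]]] [->|->] [->|->] [?|?] [?|?]; subst; auto.
move=> a b c d /uE[[/uE[[-> _]|[-> _]] /uE[[_ ->]|[-> ->]]]|]//.
move=> [/uE[[ac ad]|[ad ac]] /uE[[_ ->]|[_ ->]]]; split; congruence.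
Qed.

(** * Formulas for pairs and graphs *)

Definition fOr f g := FNeg (FAnd (FNeg f) (FNeg g)).
Definition fIff f g := FAnd (FNeg (FAnd f (FNeg g))) (FNeg (FAnd g (FNeg f))).

(** The arguments are indices of variables. Each layer binds indices above those passed to it (4 and
    5, then 6 and 7, then 8), which avoids capture. *)
Definition fUpair p a b := FAll 8 (fIff (FMem 8 p) (fOr (FEq 8 a) (FEq 8 b))).
Definition fOpair p a b :=
  FEx 6 (FEx 7 (FAnd (fUpair 6 a a) (FAnd (fUpair 7 a b) (fUpair p 6 7)))).
(* ((x_1, x_2), x_3) is an element of x_0. *)
Definition fGraph :=
  FEx 4 (FEx 5 (FAnd (fOpair 4 1 2) (FAnd (fOpair 5 4 3) (FMem 5 0)))).

Section Semantics.
Variables (V : Type) (mem : V -> V -> Prop) (u : V -> V -> V).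
Hypothesis HV : zfc_universe mem.
Hypothesis uP : forall a b, ext mem (u a b) = [set a; b].

Lemma assign_eq (s : nat -> V) n x : assign s n x n = x.
Proof. by rewrite /assign eqxx. Qed.

Lemma assign_lt (s : nat -> V) n x i : (i < n)%N -> assign s n x i = s i.
Proof. by move=> lin; rewrite /assign ltn_eqF. Qed.

Lemma holds_FEx s n g :
  holds mem setT s (FEx n g) <-> exists a, holds mem setT (assign s n a) g.
Proof. by split=> [[a _ H]|[a H]]; exists a. Qed.

Lemma holds_FAnd N s f g :
  holds mem N s (FAnd f g) <-> holds mem N s f /\ holds mem N s g.
Proof. by []. Qed.

Lemma holds_fUpair s p a b : (p < 8)%N -> (a < 8)%N -> (b < 8)%N ->
  holds mem setT s (fUpair p a b) <-> s p = u (s a) (s b).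
Proof.
move=> p8 a8 b8 /=; split=> [H|sp].
  apply: (ext_inj HV); rewrite uP; apply/seteqP; split=> z /=;
    have := H z I; rewrite !assign_eq !assign_lt// => -[H1 H2].
  - by move=> zp; apply: contrapT => nz; apply: H1; split=> // nn; apply: nn; split=> e;
      apply: nz; [left|right].
  - by move=> zab; apply: contrapT => nz; apply: H2; split=> // -[na nb]; case: zab.
move=> z _; rewrite !assign_eq !assign_lt// sp.
have -> : mem z (u (s a) (s b)) = (z = s a \/ z = s b) by rewrite -[RHS]/([set s a; s b] z) -uP.
tauto.
Qed.

Lemma holds_fOpair s p a b : (p < 6)%N -> (a < 6)%N -> (b < 6)%N ->
  holds mem setT s (fOpair p a b) <-> s p = u (u (s a) (s a)) (u (s a) (s b)).
Proof.
move=> p6 a6 b6.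
have lt7 i : (i < 6)%N -> (i < 7)%N by exact: ltnW.
have lt8 i : (i < 6)%N -> (i < 8)%N by move=> /lt7/ltnW.
have assE x y i : (i < 6)%N -> assign (assign s 6 x) 7 y i = s i.
  by move=> i6; rewrite !assign_lt ?lt7.
have asE x y : assign (assign s 6 x) 7 y 6 = x by [].
rewrite /fOpair; split.
  move=> /holds_FEx[x /holds_FEx[y /holds_FAnd[+ /holds_FAnd[]]]].
  move=> /(holds_fUpair _ _ (lt8 _ a6) (lt8 _ a6)).1-/(_ isT) +
    /(holds_fUpair _ _ (lt8 _ a6) (lt8 _ b6)).1-/(_ isT) +
    /(holds_fUpair _ (lt8 _ p6) _ _).1-/(_ isT isT).
  rewrite !assign_eq !(assE _ _ _ p6, assE _ _ _ a6, assE _ _ _ b6, asE) => <- <-; exact.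
move=> sp; apply/holds_FEx; exists (u (s a) (s a)).
apply/holds_FEx; exists (u (s a) (s b)).
apply/holds_FAnd; split; last apply/holds_FAnd; last split.
all: apply/holds_fUpair => //; try exact: lt8.
all: by rewrite ?assign_eq ?(assE _ _ _ p6, assE _ _ _ a6, assE _ _ _ b6, asE).
Qed.

Lemma holds_fGraph s : holds mem setT s fGraph <->
  mem (u (u (u (u (s 1) (s 1)) (u (s 1) (s 2))) (u (u (s 1) (s 1)) (u (s 1) (s 2))))
         (u (u (u (s 1) (s 1)) (u (s 1) (s 2))) (s 3))) (s 0).
Proof.
rewrite /fGraph; split.
  move=> /holds_FEx[x /holds_FEx[y /holds_FAnd[+ /holds_FAnd[]]]].
  move=> /(holds_fOpair _ _ _ _).1-/(_ isT isT isT) + /(holds_fOpair _ _ _ _).1-/(_ isT isT isT).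
  by rewrite /assign /= => -> ->.
move=> H; do 2![apply/holds_FEx; eexists].
apply/holds_FAnd; split; last apply/holds_FAnd; last split.
- by apply/holds_fOpair => //; rewrite /assign /=.
- by apply/holds_fOpair => //; rewrite /assign /=.
- exact: H.
Qed.

End Semantics.

(** * From Skolem-like functions to models *)

(** Absoluteness of the existential formula moves the witness into [M]; absoluteness of [f] then
    turns its relativized truth back into truth in [V]. *)
Lemma absolute_FEx V (mem : V -> V -> Prop) M n f s :
  absolute mem M f -> absolute mem M (FEx n f) ->
  (forall i, i \in free_vars (FEx n f) -> ext mem M (s i)) ->
  holds mem setT s (FEx n f) ->
  exists2 a, ext mem M a & holds mem setT (assign s n a) f.
Proof.
move=> Mf Mnf sM /(Mnf _ sM)[a Ma fa]; exists a => //; apply/Mf => // i fi.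
rewrite /assign; case: eqVneq => // ni; apply: sM.
by rewrite /= mem_filter ni.
Qed.

Definition closure_formulas := [:: fGraph; FEx 3 fGraph].

Section FunctionGraphs.
Variables (V : Type) (mem : V -> V -> Prop).
Hypothesis HV : zfc_universe mem.
Variables (X : Type) (e : X -> V).
Hypothesis He : is_set_in_universe mem e.

(** [G] is the graph of [g]. Some [y] in [M] satisfies ((e a, e b), y) in [G], and the only such [y]
    is [e (g a b)]. *)
Lemma ex_graph (g : X -> X -> X) : exists G : V, forall C M : V,
  suitable_model mem closure_formulas C M -> ext mem M G ->
  forall a b, ext mem M (e a) -> ext mem M (e b) -> ext mem M (e (g a b)).
Proof.
have [einj _] := He; have [u uP] := ex_upair HV.
pose op a b := u (u a a) (u a b).
have opI a b c d : op a b = op c d -> a = c /\ b = d by exact: opair_inj uP _ _ _ _.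
have [G GP] := small_range2 HV He (fun a b => op (op (e a) (e b)) (e (g a b))).
exists G => C M [_ MPhi] MG a b Ma Mb.
have {MPhi} [M1 M2] : absolute mem M fGraph /\ absolute mem M (FEx 3 fGraph).
  by inversion MPhi as [|? ? H1 H2]; inversion H2.
(* x_0 is [G], x_1 is [e a], and all later variables are [e b], so every value lies in [M]. *)
pose s i := nth (e b) [:: G; e a] i.
have [i||y My] := absolute_FEx M1 M2 (s := s).
- by case: i => [|[|[|i]]].
- apply/holds_FEx; exists (e (g a b)); apply/(holds_fGraph HV uP).
  suff : ext mem G (op (op (e a) (e b)) (e (g a b))) by [].
  by rewrite GP; exists a, b.
move=> /(holds_fGraph HV uP); rewrite /assign /= => yG.
have : ext mem G (op (op (e a) (e b)) y) by [].
by rewrite GP => -[a' [b' /opI[/opI[/einj-> /einj->] <-]]].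
Qed.

End FunctionGraphs.

(** (S-c) applied to [A] as the up-directed union of its finite subsets, each listed by a
    sequence. *)
Lemma skolem_like_finite T (phi : set T -> set T) A x : skolem_like phi ->
  phi A x -> exists s, all_prop A s /\ phi [set y | List.In y s] x.
Proof.
move=> [_ _ phic].
have AP s : all_prop A s <-> forall y, List.In y s -> A y.
  elim: s => //= y s ->; split; first by move=> [Ay As] z [<-|/As].
  by move=> As; split; [apply: As; left|move=> z sz; apply: As; right].
have {1}-> : A = \bigcup_(B in [set [set y | List.In y s] | s in all_prop A]) B.
  rewrite bigcup_image; apply/seteqP; split=> [y Ay|y [s /AP As /As//]].
  by exists [:: y] => //; left.
rewrite phic; last first.
  split; first by exists set0, [::] => //; apply/seteqP; split.
  move=> _ _ [s As <-] [t At <-]; exists [set y | List.In y (s ++ t)].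
    by exists (s ++ t) => //; apply/all_prop_cat.
  by move=> y [ys|yt]; apply/List.in_or_app; [left|right].
by move=> [_ [s As <-] sx]; exists s.
Qed.

Lemma large_skolem_models (V : Type) (mem : V -> V -> Prop) (X : topologicalType)
    (e : X -> V) (S : set (set X)) : zfc_universe mem -> is_set_in_universe mem e ->
  large_skolem S ->
  exists2 S0 : set (set X), S0 `<=` S & exceedingly_large_models mem e S0.
Proof.
move=> HV He [phi phiS ->]; have [einj _] := He.
have [phi1 _ _] := phiS.
(* For countable [X] all points are put into [C]: every model then contains [X], and the only trace
   is [phi setT]. *)
have [cX|ncX] := pselect (countable [set: X]).
  have cR : countable (range e) by apply: card_le_trans (card_image_le _ _) cX.
  have [C CP] := small_countable HV cR.
  exists [set closure (e @^-1` ext mem M) | M in suitable_model mem [::] C]; last first.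
    by exists [::], C; split=> //; rewrite CP.
  move=> _ [M [CM _] <-]; exists setT => //; congr closure.
  apply/seteqP; split=> x _ /=; first by apply: CM; rewrite CP; exists x.
  by have [+ _] := phi1 setT; apply.
have infX : infinite_set [set: X] by move=> /finite_set_countable.
have allT s : all_prop [set: X] s by elim: s.
have [x0 _] := infinite_setN0 infX.
have [c [_ cinj]] := card_le_ex_inj x0 (card_all_prop infX (card_lexx [set: X])).
have /choice[d dP] : forall x, exists s, forall s', c s' = x -> s' = s.
  move=> x; have [[s <-]|ns] := pselect (exists s, c s = x).
    by exists s => s'; apply: cinj; exact: allT.
  by exists [::] => s' cs'; case: ns; exists s'.
have dc s : d (c s) = s by rewrite -(dP _ s).
have /choice[p pP] : forall s, exists p : nat -> X, phi [set y | List.In y s] `<=` range p.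
  move=> s; apply: countable_ex_range x0 _.
  apply: card_le_trans (phi1 _).2 _; apply: max_omega_countable.
  apply: finite_set_countable; elim: s => [|x s IH].
    by apply: (sub_finite_set (B := set0)) => //; exact: finite_set0.
  apply: (sub_finite_set (B := [set x] `|` [set y | List.In y s])).
    by move=> y [<-|]; [left|right].
  by rewrite finite_setU; split.
(* [g 0] prepends a point to a coded sequence; [g k.+1] gives the [k]-th point enumerated for the
   sequence coded by [a], whatever [b] is. *)
pose g (k : nat) (a b : X) := if k is k'.+1 then p (d a) k' else c (a :: d b).
have /choice[G GP] := fun k => ex_graph HV He (g k).
have [C CP] : small mem (e (c [::]) |` range G).
  apply: (small_countable HV); apply: countableU => //.
  exact: card_image_le.
exists [set closure (e @^-1` ext mem M) | M in suitable_model mem closure_formulas C]; last first.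
  exists closure_formulas, C; split=> //; rewrite CP; apply: countableU => //.
  exact: card_image_le.
move=> _ [M sM <-]; set A := _ @^-1` _; have [CM _] := sM.
have Ag k a b : A a -> A b -> A (g k a b).
  by apply: (GP k _ _ sM); apply: CM; rewrite CP; right; exists k.
have Ac s : all_prop A s -> A (c s).
  elim: s => [_|x s IH /= [Ax /IH As]]; first by apply: CM; rewrite CP; left.
  by rewrite -[s]dc; exact: (Ag 0 x).
exists A => //; congr closure; apply/seteqP; split; last exact: (phi1 A).1.
move=> x /(skolem_like_finite phiS)[s [As /pP[k _ <-]]].
by have := Ag k.+1 _ _ (Ac _ As) (Ac _ As); rewrite /g dc.
Qed.

(** * Skolem hulls *)

Fixpoint subformulas (f : formula) : seq formula :=
  f :: match f with
       | FMem _ _ | FEq _ _ => [::]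
       | FNeg g | FAll _ g | FEx _ g => subformulas g
       | FAnd g h => subformulas g ++ subformulas h
       end.

Lemma all_prop_mkseq T (P : T -> Prop) (s : nat -> T) n :
  (forall i, P (s i)) -> all_prop P (mkseq s n).
Proof. by move=> Ps; rewrite /mkseq; elim: n 0 => //= n IH m; split. Qed.

Lemma all_prop_set_nth T (P : T -> Prop) x0 s i y :
  P x0 -> all_prop P s -> P y -> all_prop P (set_nth x0 s i y).
Proof.
move=> Px0; elim: s i => [|x s IH] [|i] //=; last 2 first.
- by move=> [].
- by move=> [Px Ps] Py; split=> //; exact: IH.
move=> _ Py; split=> //; rewrite -[ncons _ _ _]/(ncons i x0 [:: y]).
by elim: i => //= i IHi; split.
Qed.

Section Formulas.
Variables (V : Type) (mem : V -> V -> Prop).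

Lemma eq_holds N (s s' : nat -> V) f :
  (forall i, i \in free_vars f -> s i = s' i) -> holds mem N s f <-> holds mem N s' f.
Proof.
have bound n g s1 s2 : (forall i, i \in free_vars (FEx n g) -> s1 i = s2 i) ->
    forall a i, i \in free_vars g -> assign s1 n a i = assign s2 n a i :> V.
  move=> ss a i gi; rewrite /assign; case: eqVneq => // ni; apply: ss.
  by rewrite mem_filter ni.
elim: f s s' => [i j|i j|f IH|f IHf g IHg|n f IH|n f IH] s s' ss /=.
- by rewrite !ss ?inE ?eqxx ?orbT.
- by rewrite !ss ?inE ?eqxx ?orbT.
- by have := IH _ _ ss; tauto.
- have ef : holds mem N s f <-> holds mem N s' f.
    by apply: IHf => i fi; apply: ss; rewrite mem_cat fi.
  have eg : holds mem N s g <-> holds mem N s' g.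
    by apply: IHg => i gi; apply: ss; rewrite mem_cat gi orbT.
  tauto.
- by split=> H a Na; apply/(IH _ _ (bound n f s s' ss a)); exact: H.
- by split=> -[a Na H]; exists a => //; apply/(IH _ _ (bound n f s s' ss a)).
Qed.

Variable v0 : V.

(** A list [l] stands for the assignment that continues it by [v0], so Skolem functions have
    finitely many arguments and fit into [hull]. For a universal formula the value is a
    counterexample, if there is one. *)
Definition skolem_function (sk : formula -> seq V -> V) := forall l n f,
  ((exists a, holds mem setT (assign (nth v0 l) n a) f) ->
     holds mem setT (assign (nth v0 l) n (sk (FEx n f) l)) f) /\
  ((exists a, ~ holds mem setT (assign (nth v0 l) n a) f) ->
     ~ holds mem setT (assign (nth v0 l) n (sk (FAll n f) l)) f).

Lemma ex_skolem_function : exists sk, skolem_function sk.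
Proof.
have wit (P : V -> Prop) : exists a, (exists b, P b) -> P a.
  by have [[b Pb]|nP] := pselect (exists b, P b); [exists b|exists v0 => /nP].
have /choice[sk skP] : forall fl : formula * seq V, exists a, match fl.1 with
    | FEx n f => (exists b, holds mem setT (assign (nth v0 fl.2) n b) f) ->
        holds mem setT (assign (nth v0 fl.2) n a) f
    | FAll n f => (exists b, ~ holds mem setT (assign (nth v0 fl.2) n b) f) ->
        ~ holds mem setT (assign (nth v0 fl.2) n a) f
    | _ => True end.
  move=> [[i j|i j|f|f g|n f|n f] l] /=; do ?by exists v0.
    exact: (wit (fun a => ~ holds mem setT (assign (nth v0 l) n a) f)).
  exact: (wit (fun a => holds mem setT (assign (nth v0 l) n a) f)).
by exists (fun f l => sk (f, l)) => l n f; split;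
  [exact: (skP (FEx n f, l))|exact: (skP (FAll n f, l))].
Qed.

Lemma assign_nth l n a : assign (nth v0 l) n a = nth v0 (set_nth v0 l n a).
Proof. by apply/funext => i; rewrite nth_set_nth. Qed.

Variables (sk : formula -> seq V -> V) (N : set V).
Hypotheses (skP : skolem_function sk) (Nv0 : N v0).

(* Tarski-Vaught *)
Lemma skolem_closed_elementary f :
  (forall g l, List.In g (subformulas f) -> all_prop N l -> N (sk g l)) ->
  forall l, all_prop N l ->
    holds mem setT (nth v0 l) f <-> holds mem N (nth v0 l) f.
Proof.
elim: f => [i j|i j|f IH|f IHf g IHg|n f IH|n f IH] Nsk l Nl //=.
- have := IH (fun g l gf => Nsk g l (or_intror gf)) l Nl; tauto.
- have := IHf (fun h l hf => Nsk h l (or_intror (List.in_or_app _ _ _ (or_introl hf)))) l Nl.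
  have := IHg (fun h l hg => Nsk h l (or_intror (List.in_or_app _ _ _ (or_intror hg)))) l Nl.
  tauto.
- have {}IH a : N a -> holds mem setT (assign (nth v0 l) n a) f <->
      holds mem N (assign (nth v0 l) n a) f.
    move=> Na; rewrite assign_nth; apply: IH (fun g l gf => Nsk g l (or_intror gf)) _ _.
    exact: all_prop_set_nth.
  split=> H a Na; first by apply/IH => //; exact: H.
  (* If some [a] refuted [f] in [V], so would the Skolem value, which lies in [N]. *)
  apply: contrapT => nH; have Nsa := Nsk _ l (or_introl erefl) Nl.
  by apply: ((skP l n f).2 (ex_intro _ a nH)); apply/IH => //; exact: H.
- have {}IH a : N a -> holds mem setT (assign (nth v0 l) n a) f <->
      holds mem N (assign (nth v0 l) n a) f.
    move=> Na; rewrite assign_nth; apply: IH (fun g l gf => Nsk g l (or_intror gf)) _ _.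
    exact: all_prop_set_nth.
  split=> [[a _ H]|[a Na /(IH _ Na) H]]; last by exists a.
  have Nsa := Nsk _ l (or_introl erefl) Nl.
  by exists (sk (FEx n f) l) => //; apply/IH => //; apply: (skP l n f).1; exists a.
Qed.

Lemma skolem_closed_absolute M f : ext mem M = N ->
  (forall g l, List.In g (subformulas f) -> all_prop N l -> N (sk g l)) ->
  absolute mem M f.
Proof.
move=> MN Nsk s; rewrite MN => sN; pose s' i := if i \in free_vars f then s i else v0.
pose l := mkseq s' (\max_(i <- free_vars f) i).+1.
have ls i : i \in free_vars f -> s i = nth v0 l i.
  move=> fi; rewrite nth_mkseq /s' ?fi// ltnS.
  by apply: (@leq_bigmax_seq _ _ xpredT id).
have Nl : all_prop N l.
  by apply: all_prop_mkseq => i; rewrite /s'; case: ifP => // /sN.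
by rewrite !(eq_holds _ ls); exact: skolem_closed_elementary.
Qed.

End Formulas.

Lemma ex_skolem_like_models (V : Type) (mem : V -> V -> Prop) (X : Type) (e : X -> V)
    (Phi : seq formula) (C : V) (q : nat -> X -> X) :
  zfc_universe mem -> is_set_in_universe mem e -> countable (ext mem C) ->
  exists psi : set X -> set X, [/\ skolem_like psi,
    forall A n x, psi A x -> psi A (q n x),
    forall A, psi (psi A) `<=` psi A &
    forall A, exists2 M, suitable_model mem Phi C M & psi A = e @^-1` ext mem M].
Proof.
move=> HV He cC; have [einj _] := He.
have [_ [[v0 _ _] _]] := zfc_infinity HV.
have [sk skP] := ex_skolem_function mem v0.
have [cst cstP] := countable_ex_range v0 cC.
(* [q'] is [q] carried to [V] along [e], with value [v0] off the range of [e]. *)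
have /choice[q' q'P] : forall nv : nat * V, exists w, forall x, nv.2 = e x -> w = e (q nv.1 x).
  move=> [n v] /=; have [[x ->]|nx] := pselect (exists x, v = e x).
    by exists (e (q n x)) => y /einj->.
  by exists v0 => x vx; case: nx; exists x.
have nthE s i : List.nth i s (FEq 0 0) = nth (FEq 0 0) s i.
  by elim: s i => [|g s IH] [|i] /=.
pose Phi' := List.flat_map subformulas Phi.
(* The operations are numbered by pairs (kind, index): constants covering [C], the functions [q],
   Skolem functions of the subformulas of [Phi], and the constant [v0]. *)
pose F (n : nat) (l : seq V) : V := match unpickle n with
  | Some (0, i) => cst i
  | Some (1, i) => q' (i, head v0 l)
  | Some (2, i) => sk (nth (FEq 0 0) Phi' i) l
  | _ => v0
  end.
have F0 i l : F (pickle (0, i)) l = cst i by rewrite /F pickleK.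
have F1 i l : F (pickle (1, i)) l = q' (i, head v0 l) by rewrite /F pickleK.
have F2 i l : F (pickle (2, i)) l = sk (nth (FEq 0 0) Phi' i) l by rewrite /F pickleK.
have F3 l : F (pickle (3, 0)) l = v0 by rewrite /F pickleK.
pose H := hull e F.
exists (fun A => e @^-1` H A); split.
- exact: skolem_like_hull.
- move=> A n x Hx; suff : H A (F (pickle (1, n)) [:: e x]).
    by rewrite F1 (q'P (n, e x) x).
  exact: hull_op.
- by move=> A x; exact: hull_preimage.
move=> A; have [M MP] : small mem (H A).
  apply: (small_le_max_omega HV He); apply: card_hull; first exact: infinite_max_omega.
  exact: card_le_max_omega.
exists M; last by rewrite MP.
split; first by rewrite MP => v /cstP[i _ <-]; rewrite -(F0 i [::]); exact: hull_op.
have Hsk f l : List.In f Phi' -> all_prop (H A) l -> H A (sk f l).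
  move=> /(List.In_nth _ _ (FEq 0 0))[i [_ <-]] Hl.
  by rewrite nthE -F2; exact: hull_op.
have Hv0 : H A v0 by rewrite -(F3 [::]); exact: hull_op.
apply/List.Forall_forall => f Phif; apply: (skolem_closed_absolute skP Hv0 MP) => g l gf.
by apply: Hsk; apply/List.in_flat_map; exists f.
Qed.

(** * Metrizable spaces *)

(** All that is retained of a metric: [U n x y] stands for d(x, y) < 1/(n+1), and [unif_half] for
    the triangle inequality. *)
Record countable_uniformity (X : topologicalType) (U : nat -> X -> X -> Prop) : Prop :=
  CountableUniformity {
  unif_refl : forall n x, U n x x ;
  unif_sym : forall n x y, U n x y -> U n y x ;
  unif_half : forall n, exists m, forall x y z, U m x y -> U m y z -> U n x z ;
  unif_closure : forall A x, closure A x <-> forall n, exists2 a, A a & U n x a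
}.

Lemma metrizable_countable_uniformity (R : realType) (X : topologicalType) :
  metrizable R X -> exists U : nat -> X -> X -> Prop, countable_uniformity U.
Proof.
move=> [M [f [g [fK gK fc gc]]]].
exists (fun n x y => ball (f x) (n.+1%:R^-1)%R (f y)); split.
- by move=> n x; exact: ballxx.
- by move=> n x y; exact: ball_sym.
(* The index 2n+1 has radius 1/(2n+2), half of 1/(n+1). *)
- move=> n; exists (n.*2.+1) => x y z xy yz.
  have -> : (n.+1%:R^-1 = n.*2.+2%:R^-1 + n.*2.+2%:R^-1 :> R)%R.
    by rewrite -doubleS -mul2n natrM invfM [(2^-1 * _)%R]mulrC -splitr.
  exact: ball_triangle yz.
move=> A x; split=> [clA n|H B].
  have : nbhs x (f @^-1` ball (f x) (n.+1%:R^-1)%R) by apply: fc; exact: nbhsx_ballx.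
  by move=> /clA[a [Aa fa]]; exists a.
rewrite -{1}[x]fK => /gc/nbhs_ballP[eps /= eps0 sB].
have [n neps] : exists n, (n.+1%:R^-1 < eps)%R.
  have := near_infty_natSinv_lt (PosNum eps0); case=> n _ /(_ n (leqnn n)) ?.
  by exists n.
have [a Aa xa] := H n; exists a; split=> //.
by rewrite -[a]fK; apply: sB; apply: le_ball xa; exact: ltW.
Qed.

Section Uniformity.
Variables (X : topologicalType) (U : nat -> X -> X -> Prop).
Hypothesis HU : countable_uniformity U.

Lemma maximal_separated n : exists D : set X,
  (forall p q, D p -> D q -> U n p q -> p = q) /\ forall x, exists2 p, D p & U n x p.
Proof.
have [|D [Dsep Dmax]] := @Zorn_bigcup _
    (fun D : set X => forall p q, D p -> D q -> U n p q -> p = q).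
  move=> F FP Ftot p q [A FA Ap] [B FB Bq]; have [AB|BA] := Ftot _ _ FA FB.
    by apply: (FP _ FB) => //; exact: AB.
  by apply: (FP _ FA) => //; exact: BA.
exists D; split=> // x; apply: contrapT => nx.
have far p : D p -> ~ U n x p by move=> Dp xp; apply: nx; exists p.
apply: (Dmax (x |` D)).
  split; first by move=> p; right.
  by move=> /(_ x (or_introl erefl)) /far; apply; exact: unif_refl.
move=> p q [->|Dp] [->|Dq] // pq; first by case: (far q).
- by case: (far p) => //; exact: unif_sym.
- exact: Dsep.
Qed.

(* [D] is the union of maximal 1/n-separated sets [D n]; a point of [D n] near
   [x] is within 1/n of [c n x], and [q n x] is the only point of [D n] within
   1/2n of [x], so that a set closed under all [q n] contains the points of [D]
   that it accumulates at. *)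
Lemma ex_trace : exists (D : set X) (c q : nat -> X -> X),
  [/\ forall n x, D (c n x), forall n x, U n x (c n x) &
  forall A, (forall n x, A x -> A (q n x)) -> D `&` closure A = D `&` A].
Proof.
have /choice[D DP] := maximal_separated.
have /choice[c cP] : forall nx : nat * X, exists p, D nx.1 p /\ U nx.1 nx.2 p.
  by move=> [n x]; have [p Dp xp] := (DP n).2 x; exists p.
have /choice[half halfP] := unif_half HU.
have /choice[q qP] : forall nx : nat * X, exists p,
    (exists2 p', D nx.1 p' & U (half nx.1) nx.2 p') -> D nx.1 p /\ U (half nx.1) nx.2 p.
  move=> [n x] /=; have [[p Dp xp]|np] := pselect (exists2 p', D n p' & U (half n) x p').
    by exists p.
  by exists x => /np.
exists (\bigcup_n D n), (fun n x => c (n, x)), (fun n x => q (n, x)); split.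
- by move=> n x; exists n => //; exact: (cP (n, x)).1.
- by move=> n x; exact: (cP (n, x)).2.
move=> A Aq; apply/seteqP; split=> p [Dp Ap]; split=> //; last exact: subset_closure.
have [n _ Dnp] := Dp; have [x Ax px] := (unif_closure HU A p).1 Ap (half n).
have [|Dq xq] := qP (n, x); first by exists p => //; exact: unif_sym.
suff -> : p = q (n, x) by exact: Aq.
by apply: (DP n).1 => //; apply: halfP px xq.
Qed.

(** Density is monotone here: for each [x] in [G] and each [n], choose a point of [Y] that is
    [U n]-close to [x], if any. The chosen points are dense in [Y], and there are countably many for
    each [x]. *)
Lemma is_dens_sub (Y F E G : set X) : Y `<=` F -> is_dens Y E -> is_dens F G ->
  E #<= max_omega G.
Proof.
move=> YF [_ Emin] [[GF FG] _].
have /choice[r rP] : forall nx : nat * X, exists y, (exists2 y', Y y' & U nx.1 nx.2 y') ->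
    Y y /\ U nx.1 nx.2 y.
  move=> [n x] /=; have [[y Yy xy]|ny] := pselect (exists2 y', Y y' & U n x y').
    by exists y.
  by exists x => /ny.
pose W t := if t is GenTree.Leaf x then range (fun n => r (n, x)) else set0.
have cW t : countable (W t).
  by case: t => [x|n l] /=; [exact: card_image_le|exact: countable0].
have WG := card_bigcup_tree_over (@infinite_max_omega _ G) (card_le_max_omega G) cW.
apply: (card_le_trans _ WG).
(* Where no point of [Y] is close, [r] returns [x] itself; intersecting with [Y] discards such
   values. *)
apply: (@card_le_trans _ _ _ (Y `&` \bigcup_(t in tree_over G) W t)); last first.
  by apply: subset_card_le => x [].
apply: Emin; split; first by move=> x [].
move=> y Yy; apply/(unif_closure HU) => n; have [m mP] := unif_half HU n.
have [x Gx yx] := (unif_closure HU G y).1 (FG _ (YF _ Yy)) m.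
have [|Yr xr] := rP (m, x); first by exists y => //; exact: unif_sym.
exists (r (m, x)); last by apply: mP yx xr.
by split=> //; exists (GenTree.Leaf x) => //; exists m.
Qed.

End Uniformity.

(** Models are replaced by what their traces provide: for any prescribed [q], an idempotent
    Skolem-like [psi] with values closed under [q]. The [q] chosen is that of [ex_trace]. *)
Lemma skolem_like_rich (X : topologicalType) (U : nat -> X -> X -> Prop)
    (S : set (set X)) : countable_uniformity U ->
  (forall q : nat -> X -> X, exists psi : set X -> set X, [/\ skolem_like psi,
    forall A n x, psi A x -> psi A (q n x),
    forall A, psi (psi A) `<=` psi A &
    forall A, S (closure (psi A))]) ->
  exists2 S0 : set (set X), S0 `<=` S & exceedingly_rich S0.
Proof.
move=> HU; have [D [c [q [Dc Uc Dtrace]]]] := ex_trace HU.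
move=> /(_ q)[psi [psiS psiq psipsi psi_S]].
have [psi1 psi2 psi3] := psiS.
have psi_sub A : A `<=` psi A by exact: (psi1 A).1.
have trace A : D `&` closure (psi A) = D `&` psi A.
  by apply: Dtrace => n x; exact: psiq.
exists [set closure (psi A) | A in [set A | A `<=` D]]; first by move=> _ [A _ <-].
have S0E F : [set closure (psi A) | A in [set A | A `<=` D]] F ->
    F = closure (psi (D `&` F)).
  (* By [trace], the set [D] meets [F] in a set between [A] and [psi A]; idempotence forces [psi] of
     it to be [psi A]. *)
  move=> [A /= AD <-]; congr closure; rewrite trace; apply/seteqP; split.
    by apply: psi2 => x Ax; split; [exact: AD|exact: psi_sub].
  by move=> x px; apply: psipsi; apply: psi2 px => y [].
split.
- by move=> _ [A _ <-]; exact: closed_closure.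
- move=> Y; have [E dE] := ex_dens Y; have [[EY YE] _] := dE.
  (* [E] need not lie in [D], so each of its points is replaced by its approximations [c n x] in
     [D], which accumulate at it. *)
  pose W t := if t is GenTree.Leaf x then range (fun n => c n x) else set0.
  pose A := \bigcup_(t in tree_over E) W t.
  have cW t : countable (W t).
    by case: t => [x|n l] /=; [exact: card_image_le|exact: countable0].
  have AE : A #<= max_omega E.
    exact: card_bigcup_tree_over (@infinite_max_omega _ E) (card_le_max_omega E) cW.
  have AD : A `<=` D by move=> _ [[x|n l] _ //= [m _ <-]].
  have YF : Y `<=` closure (psi A).
    apply: subset_trans YE _; apply: closure_sub_closed; first exact: closed_closure.
    move=> x Ex; apply/(unif_closure HU) => n; exists (c n x) => //.
    by apply: psi_sub; exists (GenTree.Leaf x) => //; exists n.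
  exists (closure (psi A)); split=> //; first by exists A.
  have [G dG] := ex_dens (closure (psi A)); exists E, G; split=> //.
  (* One inequality is monotonicity of density; the other holds because [psi A] is dense in its
     closure and has size at most max(|E|, omega). *)
  rewrite card_eq_le; apply/andP; split; apply: max_omega_le2.
    exact: (is_dens_sub HU YF dE dG).
  have [_ Gmin] := dG; apply: (@card_le_trans _ _ _ (psi A)).
    by apply: Gmin; split=> //; exact: subset_closure.
  by apply: card_le_trans (psi1 A).2 _; exact: max_omega_le2.
- move=> AA AAS [[F0 AAF0] dir].
  (* The traces on [D] are up-directed, so [psi] commutes with their union, and [S0E] recovers each
     [F] from its trace. *)
  exists (\bigcup_(F in AA) (D `&` F)); first by move=> x [F _ []].
  have -> : \bigcup_(F in AA) (D `&` F) = \bigcup_(B in [set D `&` F | F in AA]) B.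
    by rewrite bigcup_image.
  rewrite psi3; last first.
    split; first by exists (D `&` F0), F0.
    move=> _ _ [F AAF <-] [G AAG <-]; have [K AAK FGK] := dir _ _ AAF AAG.
    exists (D `&` K); first by exists K.
    by move=> x [[Dx Fx]|[Dx Gx]]; split=> //; apply: FGK; [left|right].
  rewrite bigcup_image -closure_bigcup_closure; congr closure.
  by apply: eq_bigcupr => F AAF; rewrite -S0E//; exact: AAS.
Qed.

Lemma exceedingly_large_rich (V : Type) (mem : V -> V -> Prop) (R : realType)
    (X : topologicalType) (e : X -> V) (S : set (set X)) :
  zfc_universe mem -> is_set_in_universe mem e -> metrizable R X ->
  exceedingly_large_models mem e S ->
  exists2 S0 : set (set X), S0 `<=` S & exceedingly_rich S0.
Proof.
move=> HV He /metrizable_countable_uniformity[U HU] [Phi [C [cC ->]]].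
apply: (skolem_like_rich HU) => q.
have [psi [psiS psiq psipsi psiM]] := ex_skolem_like_models Phi q HV He cC.
exists psi; split=> // A; have [M sM ->] := psiM A.
by exists M.
Qed.

Theorem theorem7 (V : Type) (mem : V -> V -> Prop) (HV : zfc_universe mem)
    (R : realType) (X : topologicalType) (e : X -> V)
    (He : is_set_in_universe mem e) (S : set (set X)) :
  [/\ exceedingly_rich S ->
        exists2 S0 : set (set X), S0 `<=` S & large_skolem S0,
      large_skolem S ->
        exists2 S0 : set (set X), S0 `<=` S & exceedingly_large_models mem e S0
    & metrizable R X -> exceedingly_large_models mem e S ->
        exists2 S0 : set (set X), S0 `<=` S & exceedingly_rich S0].
Proof.
split.
- exact: exceedingly_rich_skolem.
- exact: large_skolem_models.
- exact: exceedingly_large_rich.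
Qed.
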